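(* Let $R$ be a commutative ring, $S$ a commutative $R$-algebra that is faithfully projective as an $R$-module, and $u\in Z^2(S/R,\mathbb G_m)$. Then there is an isomorphism of $R$-algebras $\gamma:\mathrm{End}_R(S)_u\to A(u)$.
   Context: Faithfully projective means finitely generated, projective and faithful. $\otimes=\otimes_R$; $\eta_i:S^{\otimes 3}\to S^{\otimes 4}$ ($1\le i\le4$) inserts $1$ in the $i$-th position, and $u_i=\eta_i(u)$. $Z^2(S/R,\mathbb G_m)$ is the group of units $u\in S^{\otimes3}$ with $u_1u_2^{-1}u_3u_4^{-1}=1$. Write $u=u^1\otimes u^2\otimes u^3$ and $u^{-1}=v^1\otimes v^2\otimes v^3$ (summations implicit). For $a,b\in S$ and $\varphi\in\mathrm{End}_R(S)$, $a\varphi b$ denotes the map $s\mapsto a\varphi(bs)$. $\mathrm{End}_R(S)_u$ is the $R$-module $\mathrm{End}_R(S)$ with multiplication $\varphi*\psi=u^3\varphi u^2\psi u^1$, i.e. $(\varphi*\psi)(s)=u^3\varphi(u^2\psi(u^1s))$; its unit is multiplication by $(u^1u^2u^3)^{-1}\in S$. $A(u)$ is the $R$-subalgebra of $S\otimes\mathrm{End}_R(S)$ (with the usual product, $\mathrm{End}_R(S)$ under composition) given by $$A(u)=\{x\in S\otimes\mathrm{End}_R(S)\;:\;x\otimes1=\Phi(1\otimes x)\},$$ where $\Phi:S\otimes S\otimes\mathrm{End}_R(S)\to S\otimes\mathrm{End}_R(S)\otimes S$, $\Phi(s\otimes t\otimes\varphi)=su^1v^1\otimes u^3\varphi v^3\otimes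 tu^2v^2$. *)

(* Defs.v *)
From HB Require Import structures.
From mathcomp Require Import all_boot all_algebra.
From mathcomp Require Import boolp.
Set Implicit Arguments. Unset Strict Implicit. Unset Printing Implicit Defensive.
Import GRing.Theory.
Local Open Scope ring_scope.
Local Open Scope quotient_scope.

(******************************************************************************)
(* MathComp's lalgType and algType exclude the zero ring.  Here the base ring *)
(* may be zero and tensor products must be algebras before one knows whether  *)
(* they vanish, and Hierarchy Builder accepts no new common descendant of     *)
(* pzRingType and lmodType.  So an algebra is an lmodType packed with an      *)
(* associative unital bilinear product, written x ** y, with unit aone A.     *)
(******************************************************************************)

Record algLaws (R : comPzRingType) (M : lmodType R) := AlgLaws {
  alg_one : M;
  alg_mul : M -> M -> M;
  alg_mulA : associative alg_mul;
  alg_1mul : left_id alg_one alg_mul;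
  alg_mul1 : right_id alg_one alg_mul;
  alg_mul_linearl : forall y, linear (fun x => alg_mul x y);
  alg_mul_linearr : forall x, linear (fun y => alg_mul x y)
}.

Structure pzAlgType (R : comPzRingType) := PzAlgType {
  alg_lmod :> lmodType R;
  alg_laws : algLaws alg_lmod
}.

Definition aone (R : comPzRingType) (A : pzAlgType R) : A :=
  alg_one (alg_laws A).
Definition amul (R : comPzRingType) (A : pzAlgType R) (x y : A) : A :=
  alg_mul (alg_laws A) x y.
Notation "x ** y" := (amul x y) (at level 40, left associativity) : ring_scope.

Structure comPzAlgType (R : comPzRingType) := ComPzAlgType {
  com_alg :> pzAlgType R;
  amulC : commutative (@amul R com_alg)
}.

Section MathCompAlgebras.
Variables (R : comNzRingType) (S : comAlgType R).

Fact algType_linearl (y : S) : linear (fun x => x * y).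
Proof. by move=> k x z; rewrite mulrDl scalerAl. Qed.
Fact algType_linearr (x : S) : linear (fun y => x * y).
Proof. by move=> k y z; rewrite mulrDr scalerAr. Qed.

Definition of_comAlgType : comPzAlgType R :=
  @ComPzAlgType R
    (PzAlgType (AlgLaws (@mulrA S) (@mul1r S) (@mulr1 S)
                  algType_linearl algType_linearr)) (@mulrC S).
End MathCompAlgebras.

Lemma linear_scale (R : comPzRingType) (U V : lmodType R) (f : U -> V) :
  linear f -> forall k x, f (k *: x) = k *: f x.
Proof. by move=> hf; exact: GRing.scalable_linear hf. Qed.

Section AlgebraTheory.
Variables (R : comPzRingType) (A : pzAlgType R).
Implicit Types x y z : A.

Lemma amulA x y z : x ** (y ** z) = x ** y ** z.
Proof. exact: alg_mulA. Qed.
Lemma amul1x x : aone A ** x = x.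
Proof. exact: alg_1mul. Qed.
Lemma amulx1 x : x ** aone A = x.
Proof. exact: alg_mul1. Qed.
Lemma amul_linearl y : linear (fun x => x ** y).
Proof. exact: alg_mul_linearl. Qed.
Lemma amul_linearr x : linear (fun y => x ** y).
Proof. exact: alg_mul_linearr. Qed.
Lemma amulDl x y z : (x + y) ** z = x ** z + y ** z.
Proof. by have := amul_linearl z 1 x y; rewrite !scale1r. Qed.
Lemma amulDr x y z : x ** (y + z) = x ** y + x ** z.
Proof. by have := amul_linearr x 1 y z; rewrite !scale1r. Qed.
Lemma amulZl k x y : (k *: x) ** y = k *: (x ** y).
Proof. exact: (linear_scale (amul_linearl y)). Qed.
Lemma amulZr k x y : x ** (k *: y) = k *: (x ** y).
Proof. exact: (linear_scale (amul_linearr x)). Qed.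
End AlgebraTheory.

Definition alg_morphism (R : comPzRingType) (A B : pzAlgType R) (f : A -> B) :=
  f (aone A) = aone B /\ forall x y, f (x ** y) = f x ** f y.

Section FaithfullyProjective.
Variables (R : comPzRingType) (M : lmodType R).

Definition finitely_generated :=
  exists n (g : 'I_n -> M), forall m, exists c : 'I_n -> R,
    m = \sum_(i < n) c i *: g i.

Definition projective :=
  forall (P Q : lmodType R) (f : {linear P -> Q}) (g : {linear M -> Q}),
    (forall q, exists p, f p = q) ->
    exists h : {linear M -> P}, forall m, f (h m) = g m.

Definition faithful := forall r : R, (forall m : M, r *: m = 0) -> r = 0.

Definition faithfully_projective :=
  [/\ finitely_generated, projective & faithful].

End FaithfullyProjective.

(******************************************************************************)
(* Hom_R(U, V) as an R-module.                                                *)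
(******************************************************************************)

Definition mkhom (R : comPzRingType) (U V : lmodType R) (f : U -> V)
    (hf : linear f) : {linear U -> V} :=
  GRing.Linear.Pack (GRing.Linear.Class
    (GRing.isNmodMorphism.Build U V f
       (GRing.nmod_morphism_semilinear (GRing.semilinear_linear hf)))
    (GRing.isScalable.Build R U V *:%R f (GRing.scalable_linear hf))).

Section Hom.
Variables (R : comPzRingType) (U V : lmodType R).
Local Notation Hom := {linear U -> V}.

Lemma homP (f g : Hom) : f =1 g -> f = g.
Proof.
case: f g => [f [[cf] [sf]]] [g [[cg] [sg]]] /= /funext efg.
case: _ / efg cg sg => cg sg.
by rewrite (Prop_irrelevance cf cg) (Prop_irrelevance sf sg).
Qed.

HB.instance Definition _ := gen_eqMixin Hom.
HB.instance Definition _ := gen_choiceMixin Hom.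

Fact hom0_linear : linear (fun _ : U => 0 : V).
Proof. by move=> k x y; rewrite scaler0 addr0. Qed.
Fact homD_linear (f g : Hom) : linear (fun x => f x + g x).
Proof. by move=> k x y; rewrite !linearP scalerDr addrACA. Qed.
Fact homN_linear (f : Hom) : linear (fun x => - f x).
Proof. by move=> k x y; rewrite [f _]linearP opprD scalerN. Qed.
Fact homZ_linear a (f : Hom) : linear (fun x => a *: f x).
Proof.
by move=> k x y; rewrite [f _]linearP scalerDr !scalerA [a * k]mulrC.
Qed.

Definition hom0 := mkhom hom0_linear.
Definition homD f g := mkhom (homD_linear f g).
Definition homN f := mkhom (homN_linear f).
Definition homZ a f := mkhom (homZ_linear a f).

Fact homDA : associative homD.
Proof. by move=> f g h; apply: homP => x /=; rewrite addrA. Qed.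
Fact homDC : commutative homD.
Proof. by move=> f g; apply: homP => x /=; rewrite addrC. Qed.
Fact hom0D : left_id hom0 homD.
Proof. by move=> f; apply: homP => x /=; rewrite add0r. Qed.
Fact homND : left_inverse hom0 homN homD.
Proof. by move=> f; apply: homP => x /=; rewrite addNr. Qed.
HB.instance Definition _ := GRing.isZmodule.Build Hom homDA homDC hom0D homND.

Fact homZA a b (f : Hom) : homZ a (homZ b f) = homZ (a * b) f.
Proof. by apply: homP => x /=; rewrite scalerA. Qed.
Fact hom1Z : left_id 1 homZ.
Proof. by move=> f; apply: homP => x /=; rewrite scale1r. Qed.
Fact homZDr : right_distributive homZ +%R.
Proof. by move=> a f g; apply: homP => x /=; rewrite scalerDr. Qed.
Fact homZDl f : {morph homZ^~ f : a b / a + b}.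
Proof. by move=> a b; apply: homP => x /=; rewrite scalerDl. Qed.
HB.instance Definition _ :=
  GRing.Zmodule_isLmodule.Build R Hom homZA hom1Z homZDr homZDl.

Lemma homDE (f g : Hom) x : (f + g) x = f x + g x. Proof. by []. Qed.
Lemma homZE a (f : Hom) x : (a *: f) x = a *: f x. Proof. by []. Qed.
End Hom.

(* End_R(S) as an R-module; its algebra structure (composition) is below.     *)
Definition EndR (R : comPzRingType) (M : lmodType R) := {linear M -> M}.
HB.instance Definition _ (R : comPzRingType) (M : lmodType R) :=
  GRing.Lmodule.on (EndR M).

Section EndAlg.
Variables (R : comPzRingType) (M : lmodType R).

Definition comp_end (f g : EndR M) : EndR M := f \o g.
Definition id_end : EndR M := idfun.

Fact comp_endA : associative comp_end. Proof. by move=> f g h; exact: homP. Qed.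
Fact comp_1end : left_id id_end comp_end. Proof. by move=> f; exact: homP. Qed.
Fact comp_end1 : right_id id_end comp_end. Proof. by move=> f; exact: homP. Qed.
Fact comp_end_linearl g : linear (comp_end^~ g).
Proof. by move=> k f h; exact: homP. Qed.
Fact comp_end_linearr f : linear (comp_end f).
Proof. by move=> k g h; apply: homP => x; exact: linearP. Qed.

Canonical end_alg := PzAlgType
  (AlgLaws comp_endA comp_1end comp_end1 comp_end_linearl comp_end_linearr).

Lemma endME (f g : EndR M) x : (f ** g : EndR M) x = f (g x).
Proof. by []. Qed.
End EndAlg.

(******************************************************************************)
(* The tensor product M (x)_R N: formal sums of pairs (m, n), represented as  *)
(* sequences, modulo the congruence generated by commutativity of the sum and *)
(* bilinearity.                                                               *)
(******************************************************************************)

Section TensorRel.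
Variables (R : comPzRingType) (M N : lmodType R).

Inductive tens_rel : seq (M * N) -> seq (M * N) -> Prop :=
| TensRefl s : tens_rel s s
| TensSym s t : tens_rel s t -> tens_rel t s
| TensTrans s t r : tens_rel s t -> tens_rel t r -> tens_rel s r
| TensCat s s' t t' : tens_rel s s' -> tens_rel t t' ->
    tens_rel (s ++ t) (s' ++ t')
| TensCatC s t : tens_rel (s ++ t) (t ++ s)
| TensAddl m m' n : tens_rel [:: (m + m', n)] [:: (m, n); (m', n)]
| TensAddr m n n' : tens_rel [:: (m, n + n')] [:: (m, n); (m, n')]
| TensScale k m n : tens_rel [:: (k *: m, n)] [:: (m, k *: n)]
| TensZero n : tens_rel [:: (0, n)] [::].

Definition tens_relb (s t : seq (M * N)) := `[< tens_rel s t >].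

Fact tens_relb_refl : reflexive tens_relb.
Proof. by move=> s; apply/asboolP/TensRefl. Qed.
Fact tens_relb_sym : symmetric tens_relb.
Proof. by move=> s t; apply/asboolP/asboolP => /TensSym. Qed.
Fact tens_relb_trans : transitive tens_relb.
Proof. by move=> s t r /asboolP h /asboolP h'; apply/asboolP/(TensTrans h h'). Qed.

Canonical tens_equiv :=
  EquivRel tens_relb tens_relb_refl tens_relb_sym tens_relb_trans.

Definition tens_type := {eq_quot tens_equiv}.

HB.instance Definition _ := Choice.on tens_type.
HB.instance Definition _ := EqQuotient.on tens_type.

End TensorRel.

Section TensorModule.
Variables (R : comPzRingType) (M N : lmodType R).
Implicit Types (s t : seq (M * N)).
Notation T := (tens_type M N).

Definition tpi s : T := \pi_T s.

Lemma tpiP s t : tens_rel s t <-> tpi s = tpi t.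
Proof.
by split=> [h|/eqmodP/asboolP//]; apply/eqmodP/asboolP.
Qed.

Lemma tpi_repr (x : T) : tpi (repr x) = x. Proof. exact: reprK. Qed.

Definition tens_add (x y : T) := tpi (repr x ++ repr y).
Definition tens_opp (x : T) := tpi [seq (- p.1, p.2) | p <- repr x].
Definition tens_scale (k : R) (x : T) := tpi [seq (k *: p.1, p.2) | p <- repr x].

Fact tpi_add s t : tpi (s ++ t) = tens_add (tpi s) (tpi t).
Proof. by apply/tpiP/TensCat; apply/tpiP; rewrite tpi_repr. Qed.

Fact tens_rel_map (f : M -> M) s t : {morph f : x y / x + y} ->
  (forall k, {morph f : x / k *: x}) ->
  tens_rel s t ->
  tens_rel [seq (f p.1, p.2) | p <- s] [seq (f p.1, p.2) | p <- t].
Proof.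
move=> fD fZ; elim=> {s t} /=.
- by move=> s; apply: TensRefl.
- by move=> s t _; apply: TensSym.
- by move=> s t r _ h _; apply: TensTrans.
- by move=> s s' t t' _ h _ h'; rewrite !map_cat; apply: TensCat.
- by move=> s t; rewrite !map_cat; apply: TensCatC.
- by move=> m m' n; rewrite fD; apply: TensAddl.
- by move=> m n n'; apply: TensAddr.
- by move=> k m n; rewrite fZ; apply: TensScale.
- move=> n; have -> : f 0 = 0 by rewrite -[in LHS](scale0r 0) fZ scale0r.
  exact: TensZero.
Qed.

Fact tpi_opp s : tpi [seq (- p.1, p.2) | p <- s] = tens_opp (tpi s).
Proof.
apply/tpiP/(@tens_rel_map -%R).
- exact: opprD.
- by move=> k x; rewrite scalerN.
- by apply/tpiP; rewrite tpi_repr.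
Qed.

Fact tpi_scale k s : tpi [seq (k *: p.1, p.2) | p <- s] = tens_scale k (tpi s).
Proof.
apply/tpiP/(@tens_rel_map ( *:%R k)).
- exact: scalerDr.
- by move=> l x; rewrite !scalerA mulrC.
- by apply/tpiP; rewrite tpi_repr.
Qed.

Fact tpi_ind (P : T -> Prop) : (forall s, P (tpi s)) -> forall x, P x.
Proof. by move=> h x; rewrite -(tpi_repr x). Qed.

Fact tens_addA : associative tens_add.
Proof.
elim/tpi_ind=> s; elim/tpi_ind=> t; elim/tpi_ind=> r.
by rewrite -!tpi_add catA.
Qed.
Fact tens_addC : commutative tens_add.
Proof.
elim/tpi_ind=> s; elim/tpi_ind=> t; rewrite -!tpi_add.
exact/tpiP/TensCatC.
Qed.
Fact tens_add0 : left_id (tpi [::]) tens_add.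
Proof. by elim/tpi_ind=> s; rewrite -tpi_add. Qed.
Fact tens_addN : left_inverse (tpi [::]) tens_opp tens_add.
Proof.
elim/tpi_ind; elim=> [|[m n] s]; rewrite -!tpi_opp -!tpi_add //= => IHs.
rewrite -IHs; apply/tpiP; apply/TensSym/(@TensTrans _ _ _ _
  ([:: (- m, n); (m, n)] ++ ([seq (- p.1, p.2) | p <- s] ++ s))).
  rewrite -{1}[_ ++ s]cat0s; apply: TensCat; last exact: TensRefl.
  apply/TensSym/(TensTrans (TensSym (TensAddl _ _ _))).
  by rewrite addNr; apply: TensZero.
apply: (@TensCat _ _ _ [:: _] [:: _]); first exact: TensRefl.
rewrite -[(m, n) :: s]cat1s catA; apply: (@TensCat _ _ _ (_ :: _)).
  exact: (@TensCatC _ _ _ [:: _]).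
exact: TensRefl.
Qed.

HB.instance Definition _ :=
  GRing.isZmodule.Build T tens_addA tens_addC tens_add0 tens_addN.

Lemma tpiD s t : tpi (s ++ t) = tpi s + tpi t.
Proof. exact: tpi_add. Qed.

Fact tens_scaleA a b x : tens_scale a (tens_scale b x) = tens_scale (a * b) x.
Proof.
elim/tpi_ind: x => s; rewrite -!tpi_scale -map_comp.
by congr tpi; apply: eq_map => -[m n] /=; rewrite scalerA.
Qed.
Fact tens_scale1 : left_id 1 tens_scale.
Proof.
elim/tpi_ind=> s; rewrite -!tpi_scale.
by congr tpi; rewrite -[RHS]map_id; apply: eq_map => -[m n] /=; rewrite scale1r.
Qed.
Fact tens_scaleDr : right_distributive tens_scale +%R.
Proof.
move=> k; elim/tpi_ind=> s; elim/tpi_ind=> t.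
by rewrite -tpiD -!tpi_scale map_cat tpiD.
Qed.
Fact tens_scaleDl x : {morph tens_scale^~ x : a b / a + b}.
Proof.
move=> a b; elim/tpi_ind: x; elim=> [|[m n] s]; rewrite -!tpi_scale.
  by rewrite addr0.
move=> IHs; have E k : tpi [seq (k *: p.1, p.2) | p <- (m, n) :: s] =
    tpi [:: (k *: m, n)] + tpi [seq (k *: p.1, p.2) | p <- s].
  by rewrite -tpiD.
rewrite !E IHs [RHS]addrACA; congr (_ + _); rewrite scalerDl.
transitivity (tpi [:: (a *: m, n); (b *: m, n)]); first exact/tpiP/TensAddl.
by rewrite -tpiD.
Qed.
HB.instance Definition _ := GRing.Zmodule_isLmodule.Build R T
  tens_scaleA tens_scale1 tens_scaleDr tens_scaleDl.

Lemma tpiZ k s : k *: tpi s = tpi [seq (k *: p.1, p.2) | p <- s].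
Proof. by rewrite tpi_scale. Qed.

Definition tens : lmodType R := T.

Definition pure_tensor (m : M) (n : N) : tens := tpi [:: (m, n)].

End TensorModule.

Notation "m *t n" := (pure_tensor m n) (at level 40, left associativity) :
  ring_scope.

Definition bilin (R : comPzRingType) (M N P : lmodType R) (f : M -> N -> P) :=
  (forall n, linear (fun m => f m n)) /\ (forall m, linear (fun n => f m n)).

Definition trilin (R : comPzRingType) (M N P Q : lmodType R)
    (f : M -> N -> P -> Q) :=
  [/\ forall n p, linear (fun m => f m n p),
      forall m p, linear (fun n => f m n p)
    & forall m n, linear (fun p => f m n p)].

Section UniversalProperty.
Variables (R : comPzRingType) (M N P : lmodType R).

Lemma pure_tensor_bilin : bilin (@pure_tensor R M N).
Proof.
have Z k m n : (k *: m) *t n = k *: (m *t n).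
  by rewrite /pure_tensor tpiZ.
split=> [n k m m'|m k n n'].
  rewrite -Z -tpiD; exact/tpiP/TensAddl.
rewrite -Z -tpiD; apply/tpiP; apply: TensTrans (TensAddr _ _ _) _.
apply: (@TensCat _ _ _ [:: _] [:: _] [:: _] [:: _]); last exact: TensRefl.
exact/TensSym/TensScale.
Qed.

Lemma tensDl m m' n : (m + m') *t n = m *t n + m' *t n :> tens M N.
Proof. by have := pure_tensor_bilin.1 n 1 m m'; rewrite !scale1r. Qed.
Lemma tensDr m n n' : m *t (n + n') = m *t n + m *t n' :> tens M N.
Proof. by have := pure_tensor_bilin.2 m 1 n n'; rewrite !scale1r. Qed.
Lemma tensZl k m n : (k *: m) *t n = k *: (m *t n) :> tens M N.
Proof. exact: (linear_scale (pure_tensor_bilin.1 n)). Qed.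
Lemma tensZr k m n : m *t (k *: n) = k *: (m *t n) :> tens M N.
Proof. exact: (linear_scale (pure_tensor_bilin.2 m)). Qed.

Lemma tens_ind (T : tens M N -> Prop) : (forall x y, T x -> T y -> T (x + y)) ->
  (forall m n, T (m *t n)) -> forall x, T x.
Proof.
move=> TD Tp; elim/tpi_ind; elim=> [|[m n] s IHs].
  have -> : tpi [::] = 0 *t 0 :> tens M N by apply/esym/tpiP/TensZero.
  exact: Tp.
have -> : tpi ((m, n) :: s) = m *t n + tpi s by rewrite -tpiD.
exact: TD.
Qed.

Lemma tens_homP (f g : {linear tens M N -> P}) :
  (forall m n, f (m *t n) = g (m *t n)) -> f =1 g.
Proof. by move=> fg; elim/tens_ind=> [x y fx fy|//]; rewrite !linearD fx fy. Qed.

Definition tlift_fun (f : M -> N -> P) (x : tens M N) :=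
  \sum_(p <- repr x) f p.1 p.2.

Fact tlift_tpi f s : bilin f -> tlift_fun f (tpi s) = \sum_(p <- s) f p.1 p.2.
Proof.
case=> fl fr.
have fD m m' n : f (m + m') n = f m n + f m' n.
  by have := fl n 1 m m'; rewrite !scale1r.
have fD' m n n' : f m (n + n') = f m n + f m n'.
  by have := fr m 1 n n'; rewrite !scale1r.
have : tens_rel (repr (tpi s)) s by apply/tpiP; rewrite tpi_repr.
rewrite /tlift_fun; move: (repr _) => r; elim=> {r s} //.
- by move=> s t r _ -> _ ->.
- by move=> s s' t t' _ h _ h'; rewrite !big_cat /= h h'.
- by move=> s t; rewrite !big_cat /= addrC.
- by move=> m m' n; rewrite !big_cons !big_nil /= !addr0.
- by move=> m n n'; rewrite !big_cons !big_nil /= !addr0.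
- move=> k m n; rewrite !big_cons !big_nil /= !addr0.
  by rewrite (linear_scale (fl n)) (linear_scale (fr m)).
- move=> n; rewrite !big_cons !big_nil /= !addr0.
  by have := linear_scale (fl n) 0 0; rewrite !scale0r.
Qed.

Fact tlift_linear f : bilin f -> linear (tlift_fun f).
Proof.
move=> hf k; elim/tpi_ind=> s; elim/tpi_ind=> t.
rewrite tpiZ -tpiD !tlift_tpi // big_cat big_map scaler_sumr; congr (_ + _).
by apply: eq_bigr => p _ /=; rewrite (linear_scale (hf.1 p.2)).
Qed.

Definition tlift f (hf : bilin f) : {linear tens M N -> P} :=
  mkhom (tlift_linear hf).

Lemma tliftE f (hf : bilin f) m n : tlift hf (m *t n) = f m n.
Proof. by rewrite /= tlift_tpi // big_seq1. Qed.

Lemma eq_tlift_linear f g h (hf : bilin f) (hg : bilin g) (hh : bilin h) k :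
  (forall m n, h m n = k *: f m n + g m n) ->
  forall x, tlift hh x = k *: tlift hf x + tlift hg x.
Proof.
move=> E; elim/tens_ind=> [x y hx hy|m n]; last by rewrite !tliftE.
by rewrite !linearD hx hy addrACA.
Qed.

End UniversalProperty.

Section Trilinear.
Variables (R : comPzRingType) (M N P Q : lmodType R).
Variables (f : M -> N -> P -> Q) (hf : trilin f).

Fact trilin_l p : bilin (fun m n => f m n p).
Proof. by case: hf => h1 h2 h3; split. Qed.
Fact trilin_r m : bilin (fun n p => f m n p).
Proof. by case: hf => h1 h2 h3; split. Qed.

Fact tlift3_bilin : bilin (fun x p => tlift (trilin_l p) x).
Proof.
split=> [p|x] k y z; first exact: linearP.
by apply: eq_tlift_linear => m n; case: hf => _ _ ->.
Qed.
Fact tlift3r_bilin : bilin (fun m x => tlift (trilin_r m) x).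
Proof.
split=> [x|m] k y z; last exact: linearP.
by apply: eq_tlift_linear => m n; case: hf => -> _ _.
Qed.

(* The linear maps induced by f on (M (x) N) (x) P and on M (x) (N (x) P).    *)
Definition tlift3 : {linear tens (tens M N) P -> Q} := tlift tlift3_bilin.
Definition tlift3r : {linear tens M (tens N P) -> Q} := tlift tlift3r_bilin.

Lemma tlift3E m n p : tlift3 (m *t n *t p) = f m n p.
Proof. by rewrite /tlift3 !tliftE. Qed.
Lemma tlift3rE m n p : tlift3r (m *t (n *t p)) = f m n p.
Proof. by rewrite /tlift3r !tliftE. Qed.
End Trilinear.

Lemma eq_tlift3_linear (R : comPzRingType) (M N P Q : lmodType R)
    (f g h : M -> N -> P -> Q) (hf : trilin f) (hg : trilin g) (hh : trilin h) k :
  (forall m n p, h m n p = k *: f m n p + g m n p) ->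
  forall x, tlift3 hh x = k *: tlift3 hf x + tlift3 hg x.
Proof.
move=> E; elim/tens_ind=> [x y hx hy|x p]; first by rewrite !linearD hx hy addrACA.
by rewrite !tliftE; apply: eq_tlift_linear => m n; exact: E.
Qed.

Lemma tens3_ind (R : comPzRingType) (M N P : lmodType R)
    (T : tens (tens M N) P -> Prop) : (forall x y, T x -> T y -> T (x + y)) ->
  (forall m n p, T (m *t n *t p)) -> forall x, T x.
Proof.
move=> TD Tp; elim/tens_ind=> [//|x p]; elim/tens_ind: x => [x y|m n //].
by rewrite tensDl; exact: TD.
Qed.

Lemma tens3r_ind (R : comPzRingType) (M N P : lmodType R)
    (T : tens M (tens N P) -> Prop) : (forall x y, T x -> T y -> T (x + y)) ->
  (forall m n p, T (m *t (n *t p))) -> forall x, T x.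
Proof.
move=> TD Tp; elim/tens_ind=> [//|m x]; elim/tens_ind: x => [x y|n p //].
by rewrite tensDr; exact: TD.
Qed.

Section TensorMap.
Variables (R : comPzRingType) (M M' N N' : lmodType R).
Variables (f : {linear M -> M'}) (g : {linear N -> N'}).

Fact tmap_bilin : bilin (fun m n => f m *t g n).
Proof.
by split=> [n|m] k x y; rewrite linearP (tensDl, tensDr) (tensZl, tensZr).
Qed.

Definition tmap : {linear tens M N -> tens M' N'} := tlift tmap_bilin.

Lemma tmapE m n : tmap (m *t n) = f m *t g n. Proof. exact: tliftE. Qed.
End TensorMap.

(******************************************************************************)
(* The tensor product of two algebras.                                        *)
(******************************************************************************)

Section TensorAlgebra.
Variables (R : comPzRingType) (A B : pzAlgType R).

Fact tens_mul_bilin2 (a : A) (b : B) : bilin (fun c d => (a ** c) *t (b ** d)).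
Proof.
by split=> [d|c] k x y;
  rewrite amulDr (tensDl, tensDr) (amulZr, amulZr) (tensZl, tensZr).
Qed.

Fact tens_mul_bilin (y : tens A B) :
  bilin (fun a b => tlift (tens_mul_bilin2 a b) y).
Proof.
by split=> [b|a] k x z; apply: eq_tlift_linear => c d;
  rewrite amulDl (tensDl, tensDr) amulZl (tensZl, tensZr).
Qed.

Definition tens_mul (x y : tens A B) : tens A B := tlift (tens_mul_bilin y) x.
Definition tens_one : tens A B := aone A *t aone B.

Lemma tens_mulE a b c d : tens_mul (a *t b) (c *t d) = (a ** c) *t (b ** d).
Proof. by rewrite /tens_mul !tliftE. Qed.

Fact tens_mul_linearl y : linear (tens_mul^~ y).
Proof. exact: linearP. Qed.
Let mulD x y z : tens_mul (x + y) z = tens_mul x z + tens_mul y z.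
Proof. exact: linearD. Qed.
Fact tens_mul_linearr x : linear (tens_mul x).
Proof.
move=> k y z; elim/tens_ind: x => [x x'|a b]; last by rewrite /tens_mul !tliftE linearP.
by rewrite !mulD => -> ->; rewrite scalerDr addrACA.
Qed.

Let Dmul x y z : tens_mul z (x + y) = tens_mul z x + tens_mul z y.
Proof. by have := tens_mul_linearr z 1 x y; rewrite !scale1r. Qed.

Fact tens_mulA : associative tens_mul.
Proof.
elim/tens_ind=> [x x' hx hx'|a b] y z; first by rewrite !mulD hx hx'.
elim/tens_ind: y => [y y' hy hy'|c d]; first by rewrite mulD !Dmul mulD hy hy'.
elim/tens_ind: z => [z z' hz hz'|e f]; first by rewrite !Dmul hz hz'.
by rewrite !tens_mulE !amulA.
Qed.
Fact tens_1mul : left_id tens_one tens_mul.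
Proof.
elim/tens_ind=> [x y hx hy|a b]; first by rewrite Dmul hx hy.
by rewrite tens_mulE !amul1x.
Qed.
Fact tens_mul1 : right_id tens_one tens_mul.
Proof.
elim/tens_ind=> [x y hx hy|a b]; first by rewrite mulD hx hy.
by rewrite tens_mulE !amulx1.
Qed.

Canonical tens_alg := @PzAlgType R (tens A B)
  (@AlgLaws R (tens A B) _ _ tens_mulA tens_1mul tens_mul1
     tens_mul_linearl tens_mul_linearr).

Lemma tensME (a c : A) (b d : B) :
  (a *t b) ** (c *t d) = (a ** c) *t (b ** d).
Proof. exact: tens_mulE. Qed.

Lemma tens1E : aone tens_alg = aone A *t aone B. Proof. by []. Qed.

Fact ins1l_linear : linear (fun b : B => aone A *t b).
Proof. by move=> k x y; rewrite tensDr tensZr. Qed.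
Fact ins1r_linear : linear (fun a : A => a *t aone B).
Proof. by move=> k x y; rewrite tensDl tensZl. Qed.

(* b |-> 1 (x) b and a |-> a (x) 1 *)
Definition ins1l : {linear B -> tens A B} := mkhom ins1l_linear.
Definition ins1r : {linear A -> tens A B} := mkhom ins1r_linear.

End TensorAlgebra.

Section TensorCom.
Variables (R : comPzRingType) (A B : comPzAlgType R).

Fact tens_mulC : commutative (@amul R (tens_alg A B)).
Proof.
elim/tens_ind=> [x x' hx hx'|a b] y; first by rewrite amulDl amulDr hx hx'.
elim/tens_ind: y => [y y' hy hy'|c d]; first by rewrite amulDl amulDr hy hy'.
by rewrite !tensME (amulC a) (amulC b).
Qed.

Canonical tens_com := ComPzAlgType tens_mulC.
End TensorCom.

Section Bimodule.
Variables (R : comPzRingType) (S : comPzAlgType R).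
Implicit Types (a b c : S) (phi psi : EndR S).

Fact bimul_subproof a phi b : linear (fun s : S => a ** phi (b ** s)).
Proof. by move=> k x y; rewrite amulDr amulZr linearP amulDr amulZr. Qed.

Definition bimul a phi b : EndR S := mkhom (bimul_subproof a phi b).

Lemma bimulE a phi b s : bimul a phi b s = a ** phi (b ** s). Proof. by []. Qed.

Lemma bimul_trilin : trilin bimul.
Proof.
split=> [phi b|a b|a phi] k x y; apply: homP => s; rewrite homDE homZE !bimulE.
- by rewrite amulDl amulZl.
- by rewrite homDE homZE amulDr amulZr.
- by rewrite amulDl amulZl linearP amulDr amulZr.
Qed.

Definition lmul a : EndR S := bimul a (idfun : EndR S) (aone S).

Lemma lmulE a s : lmul a s = a ** s. Proof. by rewrite bimulE /= amul1x. Qed.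

Lemma lmul_linear : linear lmul.
Proof. by case: bimul_trilin => h _ _; exact: h. Qed.

Fact sandwich_subproof phi psi a b c :
  linear (fun s : S => c ** phi (b ** psi (a ** s))).
Proof.
by move=> k x y; do 2 rewrite amulDr amulZr linearP; rewrite amulDr amulZr.
Qed.

Definition sandwich phi psi a b c : EndR S := mkhom (sandwich_subproof phi psi a b c).

Lemma sandwichE phi psi a b c s :
  sandwich phi psi a b c s = c ** phi (b ** psi (a ** s)).
Proof. by []. Qed.

Fact sandwich_trilin phi psi : trilin (sandwich phi psi).
Proof.
split=> [b c|a c|a b] k x y; apply: homP => s; rewrite homDE homZE !sandwichE.
- by rewrite amulDl amulZl linearP amulDr amulZr linearP amulDr amulZr.
- by rewrite amulDl amulZl linearP amulDr amulZr.
- by rewrite amulDl amulZl.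
Qed.

End Bimodule.

Notation S2 S := (tens S S).
Notation S3 S := (tens (S2 S) S).
Notation S4 S := (tens (S3 S) S).

Section Amitsur.
Variables (R : comPzRingType) (S : comPzAlgType R).

Definition eta1 : {linear S3 S -> S4 S} :=
  tmap (tmap (ins1l S S) (idfun : EndR S)) (idfun : EndR S).
Definition eta2 : {linear S3 S -> S4 S} :=
  tmap (tmap (ins1r S S) (idfun : EndR S)) (idfun : EndR S).
Definition eta3 : {linear S3 S -> S4 S} := tmap (ins1r (S2 S) S) (idfun : EndR S).
Definition eta4 : {linear S3 S -> S4 S} := ins1r (S3 S) S.

Lemma eta1E (a b c : S) : eta1 (a *t b *t c) = aone S *t a *t b *t c.
Proof. by rewrite /eta1 !tmapE. Qed.
Lemma eta2E (a b c : S) : eta2 (a *t b *t c) = a *t aone S *t b *t c.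
Proof. by rewrite /eta2 !tmapE. Qed.
Lemma eta3E (a b c : S) : eta3 (a *t b *t c) = a *t b *t aone S *t c.
Proof. by rewrite /eta3 !tmapE. Qed.
Lemma eta4E (a b c : S) : eta4 (a *t b *t c) = a *t b *t c *t aone S.
Proof. by []. Qed.

(* Z^2(S/R, G_m): a unit is stored with its (unique) inverse.  As the eta_i   *)
(* are ring morphisms, eta_i u^-1 is the inverse of eta_i u.                  *)
Record Z2 := MkZ2 {
  Z2_val : S3 S;
  Z2_inv : S3 S;
  Z2_mulV : Z2_val ** Z2_inv = aone _;
  Z2_cocycle : eta1 Z2_val ** eta2 Z2_inv ** eta3 Z2_val ** eta4 Z2_inv = aone _
}.

(* sum_i c_i phi b_i psi a_i for x = sum_i a_i (x) b_i (x) c_i; the product   *)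
(* of End_R(S)_u is tw_mul u.                                                 *)
Definition tw_mul (x : S3 S) (phi psi : EndR S) : EndR S :=
  tlift3 (sandwich_trilin phi psi) x.

Lemma tw_mulE a b c phi psi s :
  tw_mul (a *t b *t c) phi psi s = c ** phi (b ** psi (a ** s)).
Proof. by rewrite /tw_mul tlift3E. Qed.

Fact mul3_trilin : trilin (fun a b c : S => a ** b ** c).
Proof.
by split=> [b c|a c|a b] k x y; rewrite !(amulDl, amulDr, amulZl, amulZr).
Qed.

(* a (x) b (x) c |-> a b c *)
Definition mu3 : {linear S3 S -> S} := tlift3 mul3_trilin.

End Amitsur.

Section Phi.
Variables (R : comPzRingType) (S : comPzAlgType R).
Local Notation T := (tens (tens S (EndR S)) S).

Definition Phi_term (s t : S) (phi : EndR S) (a b c d e f : S) : T :=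
  (s ** a ** d) *t bimul c phi f *t (t ** b ** e).

Fact Phi_trilin1 s t phi a b c : trilin (fun d e f => Phi_term s t phi a b c d e f).
Proof.
have [_ _ h] := bimul_trilin S.
split=> [e f|d f|d e] k x y; rewrite /Phi_term.
- by rewrite !(amulDr, amulZr) !(tensDl, tensZl).
- by rewrite !(amulDr, amulZr) !(tensDr, tensZr).
- by rewrite h !(tensDr, tensZr) !(tensDl, tensZl).
Qed.

Fact Phi_trilin2 s t phi (y : S3 S) :
  trilin (fun a b c => tlift3 (Phi_trilin1 s t phi a b c) y).
Proof.
have [h _ _] := bimul_trilin S.
split=> [b c|a c|a b] k x z; apply: eq_tlift3_linear => d e f; rewrite /Phi_term.
- by rewrite !(amulDr, amulZr, amulDl, amulZl) !(tensDl, tensZl).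
- by rewrite !(amulDr, amulZr, amulDl, amulZl) !(tensDr, tensZr).
- by rewrite h !(tensDr, tensZr) !(tensDl, tensZl).
Qed.

Fact Phi_trilin3 (x y : S3 S) :
  trilin (fun s t phi => tlift3 (Phi_trilin2 s t phi y) x).
Proof.
have [_ h _] := bimul_trilin S.
split=> [t phi|s phi|s t] k z w; apply: eq_tlift3_linear => a b c;
  apply: eq_tlift3_linear => d e f; rewrite /Phi_term.
- by rewrite !(amulDl, amulZl) !(tensDl, tensZl).
- by rewrite !(amulDl, amulZl) !(tensDr, tensZr).
- by rewrite h !(tensDr, tensZr) !(tensDl, tensZl).
Qed.

(* For x = sum_i a_i (x) b_i (x) c_i and y = sum_j d_j (x) e_j (x) f_j,       *)
(* s (x) t (x) phi |->                                                        *)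
(*   sum_(i, j) s a_i d_j (x) c_i phi f_j (x) t b_i e_j.                      *)
Definition Phi_gen (x y : S3 S) : {linear tens S (tens S (EndR S)) -> T} :=
  tlift3r (Phi_trilin3 x y).

Lemma Phi_genE s t phi a b c d e f :
  Phi_gen (a *t b *t c) (d *t e *t f) (s *t (t *t phi)) =
  (s ** a ** d) *t bimul c phi f *t (t ** b ** e).
Proof. by rewrite /Phi_gen tlift3rE !tlift3E. Qed.

Definition Phi (u : Z2 S) := Phi_gen (Z2_val u) (Z2_inv u).

End Phi.

(******************************************************************************)
(* Multiplicativity of the maps in play.                                      *)
(******************************************************************************)

Section Multiplicativity.
Variables (R : comPzRingType) (A B C D : pzAlgType R).

Lemma tens3_mult (F : {linear tens (tens A B) C -> D}) :
  (forall (a a' : A) (b b' : B) (c c' : C),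
     F ((a ** a') *t (b ** b') *t (c ** c')) = F (a *t b *t c) ** F (a' *t b' *t c')) ->
  forall x y : tens (tens A B) C, F (x ** y) = F x ** F y.
Proof.
move=> FM; elim/tens3_ind=> [x x' hx hx'|a b c] y.
  by rewrite amulDl !linearD hx hx' amulDl.
elim/tens3_ind: y => [y y' hy hy'|a' b' c'].
  by rewrite amulDr !linearD hy hy' amulDr.
by rewrite !tensME FM.
Qed.

Lemma tens3r_mult (F : {linear tens A (tens B C) -> D}) :
  (forall (a a' : A) (b b' : B) (c c' : C),
     F ((a ** a') *t ((b ** b') *t (c ** c'))) =
     F (a *t (b *t c)) ** F (a' *t (b' *t c'))) ->
  forall x y : tens A (tens B C), F (x ** y) = F x ** F y.
Proof.
move=> FM; elim/tens3r_ind=> [x x' hx hx'|a b c] y.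
  by rewrite amulDl !linearD hx hx' amulDl.
elim/tens3r_ind: y => [y y' hy hy'|a' b' c'].
  by rewrite amulDr !linearD hy hy' amulDr.
by rewrite !tensME FM.
Qed.

Lemma ins1rM (x y : A) : ins1r A B (x ** y) =
  (ins1r A B x) ** (ins1r A B y).
Proof. by rewrite tensME amulx1. Qed.
Lemma ins1lM (x y : B) : ins1l A B (x ** y) =
  (ins1l A B x) ** (ins1l A B y).
Proof. by rewrite tensME amulx1. Qed.

End Multiplicativity.

Section MultLast.
Variables (R : comPzRingType) (X : pzAlgType R) (S : comPzAlgType R).

Fact mul_last_trilin : trilin (fun (x : X) (a b : S) => x *t (a ** b)).
Proof.
split=> [b c|a c|a b] k x y; rewrite ?(amulDl, amulDr, amulZl, amulZr).
- by rewrite tensDl tensZl.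
- by rewrite tensDr tensZr.
- by rewrite tensDr tensZr.
Qed.

(* x (x) a (x) b |-> x (x) a b *)
Definition mul_last : {linear tens (tens X S) S -> tens X S} :=
  tlift3 mul_last_trilin.

Lemma mul_lastE x a b : mul_last (x *t a *t b) = x *t (a ** b).
Proof. exact: tlift3E. Qed.

Lemma mul_lastM (x y : tens (tens X S) S) :
  mul_last (x ** y) = (mul_last x) ** (mul_last y).
Proof.
apply: (@tens3_mult R X S S (tens X S)) => a a' b b' c c'.
rewrite !mul_lastE tensME; congr (_ *t _).
by rewrite -!amulA; congr (_ ** _); rewrite !amulA (amulC b').
Qed.

End MultLast.

Section AmitsurTheory.
Variables (R : comPzRingType) (S : comPzAlgType R).
Implicit Types (x y : S3 S) (phi psi chi : EndR S).

Lemma eta1M x y : eta1 S (x ** y) = (eta1 S x) ** (eta1 S y).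
Proof.
apply: (@tens3_mult R S S S (S4 S)) => a a' b b' c c'.
by rewrite !eta1E !tensME amulx1.
Qed.
Lemma eta2M x y : eta2 S (x ** y) = (eta2 S x) ** (eta2 S y).
Proof.
apply: (@tens3_mult R S S S (S4 S)) => a a' b b' c c'.
by rewrite !eta2E !tensME amulx1.
Qed.
Lemma eta3M x y : eta3 S (x ** y) = (eta3 S x) ** (eta3 S y).
Proof.
apply: (@tens3_mult R S S S (S4 S)) => a a' b b' c c'.
by rewrite !eta3E !tensME amulx1.
Qed.
Lemma eta4M x y : eta4 S (x ** y) = (eta4 S x) ** (eta4 S y).
Proof. exact: ins1rM. Qed.

Lemma eta2_1 : eta2 S (aone _) = (aone _). Proof. exact: eta2E. Qed.
Lemma eta4_1 : eta4 S (aone _) = (aone _). Proof. exact: eta4E. Qed.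

Lemma mu3M x y : mu3 S (x ** y) = mu3 S x ** mu3 S y.
Proof.
apply: (@tens3_mult R S S S S) => a a' b b' c c'; rewrite !tlift3E.
rewrite -!amulA; congr (_ ** _); rewrite !amulA (amulC (b ** c) a') -!amulA.
by congr (_ ** (_ ** _)); rewrite !amulA (amulC b').
Qed.

Lemma mu3_1 : mu3 S (aone _) = aone _.
Proof. by rewrite [LHS]tlift3E !amulx1. Qed.

Fact mul_first_trilin : trilin (fun a b c : S => (a ** b) *t c).
Proof.
split=> [b c|a c|a b] k x y; rewrite ?(amulDl, amulDr, amulZl, amulZr).
- by rewrite tensDl tensZl.
- by rewrite tensDl tensZl.
- by rewrite tensDr tensZr.
Qed.

(* a (x) b (x) c |-> a b (x) c *)
Definition mul_first : {linear S3 S -> S2 S} := tlift3 mul_first_trilin.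

Lemma mul_firstE a b c : mul_first (a *t b *t c) = (a ** b) *t c.
Proof. exact: tlift3E. Qed.

Variable u : Z2 S.
Let u' : S3 S := Z2_val u.
Let v : S3 S := Z2_inv u.

Lemma Z2_mulVr : v ** u' = aone _ :> S3 S.
Proof. by rewrite amulC; exact: Z2_mulV. Qed.

Lemma Z2_mu3V : mu3 S u' ** mu3 S v = aone _.
Proof. by rewrite -[LHS]mu3M [u' ** v]Z2_mulV mu3_1. Qed.

Lemma Z2_eq : (eta3 S u') ** (eta1 S u') =
  (eta2 S u') ** (eta4 S u').
Proof.
pose u1 : S4 S := eta1 S u'; pose u2 : S4 S := eta2 S u'.
pose u3 : S4 S := eta3 S u'; pose u4 : S4 S := eta4 S u'.
pose v2 : S4 S := eta2 S v; pose v4 : S4 S := eta4 S v.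
have e : u1 ** v2 ** u3 ** v4 = aone _ by exact: Z2_cocycle.
have e2 : v2 ** u2 = aone _ by rewrite -[LHS]eta2M Z2_mulVr eta2_1.
have e4 : v4 ** u4 = aone _ by rewrite -[LHS]eta4M Z2_mulVr eta4_1.
change (u3 ** u1 = u2 ** u4).
rewrite -[RHS]amul1x -e (amulC u3 u1) -!amulA; congr (u1 ** _).
rewrite (amulA v4) (amulC v4 u2) -(amulA u2) e4 amulx1 (amulC u3 u2).
by rewrite amulA e2 amul1x.
Qed.

(* The specializations u^1 (x) u^2 u^3 = 1 (x) mu3 u and                      *)
(* u^1 u^2 (x) u^3 = mu3 u (x) 1 of the cocycle condition, multiplied by the  *)
(* inverse of mu3 u.                                                          *)
Lemma Z2_right :
  (mul_last S S u') ** (aone S *t mu3 S v) = aone _.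
Proof.
pose p (x : S4 S) : S2 S := mul_last S S (mul_last (S2 S) S x).
pose q (x : S3 S) : S2 S := mul_last S S x.
have pM (x y : S4 S) : p (x ** y) = p x ** p y.
  by rewrite /p -[RHS]mul_lastM [mul_last _ S (x ** y)]mul_lastM.
have qvu : q v ** q u' = aone _.
  by rewrite -[LHS]mul_lastM Z2_mulVr [LHS]mul_lastE amulx1.
have p1 x : p (eta1 S x) = aone S *t mu3 S x.
  elim/tens3_ind: x => [x y hx hy|a b c].
    by rewrite !linearD tensDr -hx -hy /p !linearD.
  by rewrite eta1E /p !mul_lastE /mu3 tlift3E amulA.
have p2 x : p (eta2 S x) = q x.
  elim/tens3_ind: x => [x y hx hy|a b c].
    by rewrite /q !linearD -[mul_last S S x]hx -[mul_last S S y]hy /p !linearD.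
  by rewrite eta2E /p /q !mul_lastE amul1x.
have p3 x : p (eta3 S x) = q x.
  elim/tens3_ind: x => [x y hx hy|a b c].
    by rewrite /q !linearD -[mul_last S S x]hx -[mul_last S S y]hy /p !linearD.
  by rewrite eta3E /p /q !mul_lastE amul1x.
have p4 x : p (eta4 S x) = q x.
  elim/tens3_ind: x => [x y hx hy|a b c].
    by rewrite /q !linearD -[mul_last S S x]hx -[mul_last S S y]hy /p !linearD.
  by rewrite eta4E /p /q !mul_lastE amulx1.
have := congr1 p (Z2_cocycle u); rewrite !pM p1 p2 p3 p4 -/u' -/v.
have -> : p (aone _) = aone _ by rewrite /p !mul_lastE !amulx1.
rewrite -[_ ** q u']amulA qvu amulx1 => e.
rewrite -[LHS]amul1x -e -amulA [q v ** _]amulA qvu amul1x tensME amulx1.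
by rewrite Z2_mu3V.
Qed.

Lemma Z2_left :
  (mul_first u') ** (mu3 S v *t aone S) = aone _.
Proof.
pose p (x : S4 S) : S2 S := tmap (mu3 S) (idfun : EndR S) x.
pose q (x : S3 S) : S2 S := mul_first x.
have qM (x y : S3 S) : q (x ** y) = q x ** q y.
  apply: (@tens3_mult R S S S (S2 S)) => a a' b b' c c'.
  rewrite !mul_firstE tensME; congr (_ *t _).
  by rewrite -!amulA; congr (_ ** _); rewrite !amulA (amulC b).
have pE a b c d : p (a *t b *t c *t d) = (a ** b ** c) *t d.
  by rewrite /p tmapE /mu3 tlift3E.
have pM (x y : S4 S) : p (x ** y) = p x ** p y.
  elim/tens_ind: x y => [x x' hx hx'|x c] y.
    by rewrite amulDl /p !linearD amulDl -[LHS]/(p _ + p _) hx hx'.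
  elim/tens_ind: y => [y y' hy hy'|y d].
    by rewrite amulDr /p !linearD amulDr -[LHS]/(p _ + p _) hy hy'.
  by rewrite tensME /p !tmapE tensME mu3M.
have qvu : q v ** q u' = aone _.
  by rewrite -qM Z2_mulVr /q mul_firstE amulx1.
have p1 x : p (eta1 S x) = q x.
  elim/tens3_ind: x => [x y hx hy|a b c].
    by rewrite /q !linearD -[mul_first x]hx -[mul_first y]hy /p !linearD.
  by rewrite eta1E pE /q mul_firstE amul1x.
have p2 x : p (eta2 S x) = q x.
  elim/tens3_ind: x => [x y hx hy|a b c].
    by rewrite /q !linearD -[mul_first x]hx -[mul_first y]hy /p !linearD.
  by rewrite eta2E pE /q mul_firstE amulx1.
have p3 x : p (eta3 S x) = q x.
  elim/tens3_ind: x => [x y hx hy|a b c].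
    by rewrite /q !linearD -[mul_first x]hx -[mul_first y]hy /p !linearD.
  by rewrite eta3E pE /q mul_firstE amulx1.
have p4 x : p (eta4 S x) = mu3 S x *t aone S by rewrite /p tmapE.
have := congr1 p (Z2_cocycle u); rewrite !pM p1 p2 p3 p4 -/u' -/v.
have -> : p (aone _) = aone _ by rewrite [LHS]pE !amulx1.
by rewrite -[_ ** q v ** _]amulA qvu amulx1.
Qed.

End AmitsurTheory.

(******************************************************************************)
(* End_R(S)_u.                                                                *)
(******************************************************************************)

Definition twEnd (R : comPzRingType) (S : comPzAlgType R) (u : Z2 S) := EndR S.
HB.instance Definition _ R (S : comPzAlgType R) (u : Z2 S) :=
  GRing.Lmodule.on (twEnd u).

Section TwistedEnd.
Variables (R : comPzRingType) (S : comPzAlgType R).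
Implicit Types (x y : S3 S) (phi psi chi : EndR S).

Lemma tw_mul_linearl x psi : linear (fun phi => tw_mul x phi psi).
Proof.
move=> k phi phi'; apply: eq_tlift3_linear => a b c; apply: homP => s.
by rewrite homDE homZE !sandwichE homDE homZE amulDr amulZr.
Qed.

Lemma tw_mul_linearr x phi : linear (fun psi => tw_mul x phi psi).
Proof.
move=> k psi psi'; apply: eq_tlift3_linear => a b c; apply: homP => s.
rewrite homDE homZE !sandwichE homDE homZE amulDr amulZr linearP.
by rewrite amulDr amulZr.
Qed.

Lemma tw_mulDx x y phi psi :
  tw_mul (x + y) phi psi = tw_mul x phi psi + tw_mul y phi psi.
Proof. exact: linearD. Qed.

Fact act4_bilin phi psi chi :
  bilin (fun (x : S3 S) (d : S) => comp_end (bimul d phi (aone S)) (tw_mul x psi chi)).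
Proof.
have [h _ _] := bimul_trilin S; split=> [d|x] k y z.
  by rewrite /tw_mul linearP; exact: comp_end_linearr.
by rewrite h; exact: comp_end_linearl.
Qed.

(* a (x) b (x) c (x) d |-> d phi c psi b chi a *)
Definition act4 phi psi chi : {linear S4 S -> EndR S} :=
  tlift (act4_bilin phi psi chi).

Lemma act4E phi psi chi a b c d s : act4 phi psi chi (a *t b *t c *t d) s =
  d ** phi (c ** psi (b ** chi (a ** s))).
Proof. by rewrite /act4 tliftE /= tw_mulE amul1x. Qed.

Lemma tw_mul_assocl x y phi psi chi : tw_mul x (tw_mul y phi psi) chi =
  act4 phi psi chi ((eta3 S x) ** (eta1 S y)).
Proof.
have linl z := tw_mul_linearl z chi.
elim/tens3_ind: x => [x x' hx hx'|a b c].
  by rewrite tw_mulDx hx hx' (linearD (eta3 S)) amulDl linearD.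
elim/tens3_ind: y => [y y' hy hy'|a' b' c'].
  rewrite (linearD (eta1 S)) amulDr linearD -hy -hy' tw_mulDx.
  by have := linl (a *t b *t c) 1 (tw_mul y phi psi) (tw_mul y' phi psi);
    rewrite !scale1r.
apply: homP => s; rewrite eta1E eta3E !tensME act4E !tw_mulE.
by rewrite !amulx1 !amul1x !amulA (amulC a').
Qed.

Lemma tw_mul_assocr x y phi psi chi : tw_mul x phi (tw_mul y psi chi) =
  act4 phi psi chi ((eta2 S x) ** (eta4 S y)).
Proof.
elim/tens3_ind: x => [x x' hx hx'|a b c].
  by rewrite tw_mulDx hx hx' (linearD (eta2 S)) amulDl linearD.
elim/tens3_ind: y => [y y' hy hy'|a' b' c'].
  rewrite (linearD (eta4 S)) amulDr linearD -hy -hy' tw_mulDx.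
  by have := tw_mul_linearr (a *t b *t c) phi 1 (tw_mul y psi chi)
    (tw_mul y' psi chi); rewrite !scale1r.
apply: homP => s; rewrite eta2E eta4E !tensME act4E !tw_mulE.
by rewrite !amulx1 !amul1x !amulA (amulC a').
Qed.

Fact act2_bilin phi : bilin (fun a b : S => bimul b phi a).
Proof. by have [h1 h2 h3] := bimul_trilin S; split=> [b|a] k y z; rewrite (h1, h3). Qed.

(* a (x) b |-> b phi a *)
Definition act2 phi : {linear S2 S -> EndR S} := tlift (act2_bilin phi).

Lemma act2E phi a b s : act2 phi (a *t b) s = b ** phi (a ** s).
Proof. by rewrite /act2 tliftE. Qed.

Lemma act2_1 phi : act2 phi (aone _) = phi.
Proof. by apply: homP => s; rewrite [LHS]act2E !amul1x. Qed.

Lemma tw_lmull x m psi : tw_mul x (lmul m) psi =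
  act2 psi ((mul_last S S x) ** (aone S *t m )).
Proof.
elim/tens3_ind: x => [x x' hx hx'|a b c].
  by rewrite tw_mulDx hx hx' (linearD (mul_last S S)) amulDl linearD.
apply: homP => s; rewrite mul_lastE tensME act2E tw_mulE lmulE.
by rewrite amulx1 !amulA -(amulA c m) (amulC m b) !amulA (amulC c b).
Qed.

Lemma tw_lmulr x phi m : tw_mul x phi (lmul m) =
  act2 phi ((mul_first S x) ** (m *t aone S)).
Proof.
elim/tens3_ind: x => [x x' hx hx'|a b c].
  by rewrite tw_mulDx hx hx' (linearD (mul_first S)) amulDl linearD.
apply: homP => s; rewrite mul_firstE tensME act2E tw_mulE lmulE.
by rewrite amulx1 (amulC a b) !amulA -(amulA b m) (amulC m a) !amulA.
Qed.

Variable u : Z2 S.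

(* Multiplication by (u^1 u^2 u^3)^-1, which is mu3 of u^-1 (see Z2_mu3V).    *)
Definition tw_one : twEnd u := lmul (mu3 S (Z2_inv u)).

Fact tw_mulA : associative (tw_mul (Z2_val u) : twEnd u -> twEnd u -> twEnd u).
Proof. by move=> f g h; rewrite tw_mul_assocl tw_mul_assocr Z2_eq. Qed.
Fact tw_1mul : left_id tw_one (tw_mul (Z2_val u)).
Proof. by move=> f; rewrite tw_lmull Z2_right act2_1. Qed.
Fact tw_mul1 : right_id tw_one (tw_mul (Z2_val u)).
Proof. by move=> f; rewrite tw_lmulr Z2_left act2_1. Qed.

Fact tw_linearl (g : twEnd u) :
  linear (fun f : twEnd u => tw_mul (Z2_val u) f g : twEnd u).
Proof. exact: tw_mul_linearl. Qed.
Fact tw_linearr (f : twEnd u) :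
  linear (fun g : twEnd u => tw_mul (Z2_val u) f g : twEnd u).
Proof. exact: tw_mul_linearr. Qed.

Canonical tw_alg :=
  PzAlgType (AlgLaws tw_mulA tw_1mul tw_mul1 tw_linearl tw_linearr).

End TwistedEnd.

(******************************************************************************)
(* A(u), a subalgebra of S (x) End_R(S).                                      *)
(******************************************************************************)

Section SubalgebraA.
Variables (R : comPzRingType) (S : comPzAlgType R).
Local Notation E := (end_alg S).
Local Notation T := (tens (tens S E) S).

Fact iota_trilin : trilin (fun a b c : S => a *t (lmul c : E) *t b).
Proof.
split=> [b c|a c|a b] k x y; rewrite ?lmul_linear.
- by rewrite !(tensDl, tensZl).
- by rewrite tensDr tensZr.
- by rewrite tensDr tensZr tensDl tensZl.
Qed.
Definition iota : {linear S3 S -> T} := tlift3 iota_trilin.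

Fact tau_trilin : trilin (fun (s t : S) (phi : E) => s *t phi *t t).
Proof.
split=> [b c|a c|a b] k x y.
- by rewrite !(tensDl, tensZl).
- by rewrite tensDr tensZr.
- by rewrite tensDr tensZr tensDl tensZl.
Qed.
Definition tau : {linear tens S (tens S E) -> T} := tlift3r tau_trilin.

Lemma iotaM (x y : S3 S) : iota (x ** y) = iota x ** iota y.
Proof.
apply: (@tens3_mult R S S S T) => a a' b b' c c'.
rewrite /iota !tlift3E !tensME; congr (_ *t _ *t _).
by apply: homP => s; rewrite endME !lmulE amulA.
Qed.

Lemma tauM (x y : tens S (tens S E)) : tau (x ** y) = tau x ** tau y.
Proof.
apply: (@tens3r_mult R S S E T) => a a' b b' c c'.
by rewrite /tau !tlift3rE !tensME.
Qed.

Lemma iota1 : iota (aone _) = aone _.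
Proof.
rewrite [LHS]tlift3E; congr (_ *t _ *t _).
by apply: homP => s; rewrite lmulE amul1x.
Qed.

Lemma tau1 : tau (aone _ : tens S (tens S E)) = aone _.
Proof. exact: tlift3rE. Qed.

Lemma Phi_genM (x y : S3 S) z : Phi_gen x y z = iota x ** tau z ** iota y.
Proof.
elim/tens3r_ind: z => [z z' hz hz'|s t phi].
  by rewrite !linearD hz hz' amulDr amulDl.
elim/tens3_ind: x => [x x' hx hx'|a b c].
  rewrite (linearD (iota)) !amulDl -hx -hx' /Phi_gen !tlift3rE.
  exact: linearD.
elim/tens3_ind: y => [y y' hy hy'|d e f].
  rewrite (linearD (iota)) !amulDr -hy -hy' /Phi_gen !tlift3rE !tlift3E.
  exact: linearD.
rewrite Phi_genE /iota /tau !tlift3E tlift3rE !tensME.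
congr (_ *t _ *t _); [by rewrite (amulC s a)| |by rewrite (amulC t b)].
by apply: homP => r; rewrite !endME !lmulE.
Qed.

Variable u : Z2 S.

Lemma PhiM (x y : tens S (tens S E)) :
  Phi u (x ** y) = Phi u x ** Phi u y.
Proof.
rewrite /Phi !Phi_genM tauM -!amulA (amulA (iota (Z2_inv u))) -iotaM.
by rewrite Z2_mulVr iota1 amul1x.
Qed.

Lemma Phi1 : Phi u (aone _ : tens S (tens S E)) = (aone _).
Proof. by rewrite /Phi Phi_genM tau1 amulx1 -iotaM Z2_mulV iota1. Qed.

Definition in_A : pred (tens S E) :=
  fun x => x *t aone S == Phi u (aone S *t x).

Fact in_A_closed : GRing.submod_closed in_A.
Proof.
split; first by apply/eqP; rewrite -(scale0r 0) tensZl tensZr !scale0r linear0.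
move=> k x y /eqP hx /eqP hy; apply/eqP.
by rewrite tensDl tensZl hx hy tensDr tensZr linearP.
Qed.

HB.instance Definition _ :=
  GRing.isSubmodClosed.Build R (tens S E) in_A in_A_closed.

Record Asub := MkAsub { Asub_val :> tens S E; Asub_valP : in_A Asub_val }.

HB.instance Definition _ := [isSub for Asub_val].
HB.instance Definition _ := [Choice of Asub by <:].
HB.instance Definition _ := [SubChoice_isSubLmodule of Asub by <:].

Let Asub_valV (x : Asub) : Asub_val x *t aone S = Phi u (aone S *t Asub_val x).
Proof. exact/eqP/Asub_valP. Qed.

Fact in_A1 : in_A (aone _).
Proof. by apply/eqP; rewrite [RHS]Phi1. Qed.

Fact in_AM (x y : Asub) : in_A (Asub_val x ** Asub_val y).
Proof.
apply/eqP; transitivity ((Asub_val x *t aone S) ** (Asub_val y *t aone S)).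
  by rewrite tensME amulx1.
by rewrite !Asub_valV -PhiM tensME amulx1.
Qed.

Definition Asub_one : Asub := MkAsub in_A1.
Definition Asub_mul (x y : Asub) : Asub := MkAsub (in_AM x y).

Fact Asub_mulA : associative Asub_mul.
Proof. by move=> x y z; apply: val_inj; apply: amulA. Qed.
Fact Asub_1mul : left_id Asub_one Asub_mul.
Proof. by move=> x; apply: val_inj; apply: amul1x. Qed.
Fact Asub_mul1 : right_id Asub_one Asub_mul.
Proof. by move=> x; apply: val_inj; apply: amulx1. Qed.
Fact Asub_mul_linearl y : linear (fun x => Asub_mul x y).
Proof. by move=> k x z; apply: val_inj; apply: amul_linearl. Qed.
Fact Asub_mul_linearr x : linear (fun y => Asub_mul x y).
Proof. by move=> k y z; apply: val_inj; apply: amul_linearr. Qed.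

Canonical Asub_alg :=
  PzAlgType (AlgLaws Asub_mulA Asub_1mul Asub_mul1 Asub_mul_linearl Asub_mul_linearr).
End SubalgebraA.

(* Main.v *)
(******************************************************************************)
(* gamma(phi) = u^1 (x) u^3 phi u^2, that is, u acting on 1 (x) phi.  Reading *)
(* an endomorphism as a kernel phi(z, y), gamma(phi) is the family            *)
(* u(s, y, z) phi(z, y) indexed by s.  Multiplicativity and gamma(phi) in     *)
(* A(u) are then two rewritings of the cocycle condition.  Conversely, for x  *)
(* in A(u), y = u^-1 x satisfies the descent condition                        *)
(* y (x) 1 = sum_i 1 (x) phi_i (x) s_i, where y = sum_i s_i (x) phi_i.        *)
(* A linear r : S -> R with r 1 = 1 applied to the last factor gives          *)
(* y = 1 (x) sum_i r(s_i) phi_i.  Such an r exists as S is faithfully         *)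
(* projective.                                                                *)
(******************************************************************************)

Require Import Defs.
From HB Require Import structures.
From mathcomp Require Import all_boot all_algebra.
Set Implicit Arguments. Unset Strict Implicit. Unset Printing Implicit Defensive.
Import GRing.Theory.
Local Open Scope ring_scope.

(** [act] lets S (x) S (x) S act on S (x) End_R(S), and [actT] lets the fourth tensor power act on S
    (x) End_R(S) (x) S. Then gamma(phi) is u acting on 1 (x) phi. For y = u^-1 x, membership of x in
    A(u) says that u_2 applied to y (x) 1 equals u_3 u_4^-1 u_1 applied to [tau] of 1 (x) y. The
    cocycle condition identifies these two units, so u carries the solutions of the descent
    condition onto A(u). By [contract_descent] those solutions are the 1 (x) phi. Multiplicativity
    is u_2 u_4 = u_3 u_1, read through [act_amul] and [act_tw_mul]. *)

(** * An R-linear retraction of R -> S *)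

Section Retraction.
Variable R : comPzRingType.

(** The generators give a surjection from R^n onto M; the functionals are the coordinates of a
    section. *)
Lemma dual_basis (M : lmodType R) : finitely_generated M -> projective M ->
  exists n (g : 'I_n -> M) (f : 'I_n -> {linear M -> R^o}),
    forall m, m = \sum_(i < n) f i m *: g i.
Proof.
move=> [n [g gen]] proj; exists n, g.
have lin_comb : linear (fun c : 'rV[R]_n => \sum_(i < n) c 0 i *: g i).
  move=> k c d; rewrite scaler_sumr -big_split /=; apply: eq_bigr => i _.
  by rewrite !mxE scalerDl scalerA.
have [q|h hK] := proj _ M (mkhom lin_comb) idfun.
  have [c ->] := gen q; exists (\row_i c i).
  by apply: eq_bigr => i _; rewrite mxE.
have lin_coord i : linear (fun m => h m 0 i : R^o).
  by move=> k x y; rewrite linearP !mxE.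
by exists (fun i => mkhom (lin_coord i)) => m; rewrite -[LHS]hK.
Qed.

(** The determinant is an integer polynomial in the entries, so it respects congruence modulo an
    ideal. *)
Lemma det_cong n (I : R -> Prop) (A B : 'M[R]_n) :
    I 0 -> (forall x y, I x -> I y -> I (x + y)) ->
    (forall r x, I x -> I (r * x)) ->
  (forall i j, I (A i j - B i j)) -> I (\det A - \det B).
Proof.
move=> I0 ID IM IAB.
have IMM x y x' y' : I (x - y) -> I (x' - y') -> I (x * x' - y * y').
  move=> h h'; have -> : x * x' - y * y' = x' * (x - y) + y * (x' - y').
    by rewrite !mulrBr (mulrC x' x) (mulrC x' y) addrA subrK.
  by apply: ID; apply: IM.
rewrite /determinant; apply: (big_ind2 (fun x y => I (x - y))).
- by rewrite subrr.
- by move=> x y x' y' h h'; rewrite opprD addrACA; apply: ID.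
move=> s _; apply: (IMM _ _ _ _); first by rewrite subrr.
by apply: (big_ind2 (fun x y => I (x - y))) => //; rewrite subrr.
Qed.

(* The values f 1 of the functionals f on S form an ideal I with I S = S; the *)
(* determinant trick gives an element of 1 + I killing S, so 1 lies in I.     *)
Lemma faithfully_projective_retraction (S : comPzAlgType R) :
  faithfully_projective S -> exists r : {linear S -> R^o}, r (aone S) = 1.
Proof.
case=> fg proj faith; have [n [g [f fgE]]] := dual_basis fg proj.
pose I x := exists r : {linear S -> R^o}, r (aone S) = x.
have I0 : I 0 by exists (0 : {linear S -> R^o}).
have ID x y : I x -> I y -> I (x + y).
  by move=> [r <-] [s <-]; exists (homD r s).
have IM k x : I x -> I (k * x).
  by move=> [r <-]; exists (homZ k r).
(* The coefficients of [aone S ** g j] when [aone S], then each [g i ** g j], is expanded in the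
   dual basis. *)
pose M := \matrix_(j < n, k < n)
  \sum_(i < n) f k (g i ** g j) * f i (aone S).
have IM' j k : I (M j k).
  by rewrite mxE; elim/big_ind: _ => // i _; apply: IM; exists (f i).
have Mg j : g j = \sum_k M j k *: g k.
  rewrite -[LHS]amul1x {1}(fgE (aone S)).
  transitivity (\sum_i f i (aone S) *: (g i ** g j)).
    elim/big_rec2: _ => [|i x y _ <-]; last by rewrite amulDl amulZl.
    by rewrite -(scale0r 0) amulZl !scale0r.
  under eq_bigr => i _ do rewrite (fgE (g i ** g j)) scaler_sumr.
  rewrite exchange_big; apply: eq_bigr => k _.
  rewrite mxE scaler_suml; apply: eq_bigr => i _.
  by rewrite scalerA mulrC.
pose A : 'M[R]_n := 1%:M - M.
have Ag j : \sum_k A j k *: g k = 0.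
  under eq_bigr => k _ do rewrite !mxE scalerBl.
  rewrite sumrB (bigD1 j) //= eqxx scale1r big1 ?addr0.
    apply/eqP; rewrite subr_eq0; apply/eqP; rewrite [LHS]Mg.
    by apply: eq_bigr => k _; rewrite !mxE.
  by move=> k /negPf kj; rewrite eq_sym kj scale0r.
(* Multiplying [Ag] by the adjugate shows that [\det A] kills each [g k], hence S. *)
have dA : \det A = 0.
  apply: faith => s; rewrite (fgE s) scaler_sumr big1 // => k _.
  rewrite scalerA mulrC -scalerA.
  suff -> : \det A *: g k = 0 by rewrite scaler0.
  transitivity (\sum_l (\adj A *m A) k l *: g l).
    rewrite mul_adj_mx (bigD1 k) //= mxE eqxx mulr1n big1 ?addr0 // => l.
    by rewrite mxE eq_sym => /negPf ->; rewrite mulr0n scale0r.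
  under eq_bigr => l _ do rewrite mxE scaler_suml.
  rewrite exchange_big big1 // => j _.
  under eq_bigr => l _ do rewrite -scalerA.
  by rewrite -scaler_sumr Ag scaler0.
have : I (\det (1%:M : 'M[R]_n) - \det A).
  apply: det_cong => // i j; rewrite /A !mxE opprB addrCA subrr addr0.
  by have := IM' i j; rewrite mxE.
by rewrite det1 dA subr0.
Qed.

End Retraction.

(** * Tensor powers of S acting on S (x) End_R(S) and S (x) End_R(S) (x) S *)

Section Action.
Variables (R : comPzRingType) (S : comPzAlgType R).
Local Notation E := (end_alg S).
Local Notation SE := (tens S E).
Local Notation T := (tens SE S).
Implicit Types (a b c d s t : S) (phi psi : E) (x y : S3 S).

Lemma lmulM a b : lmul (a ** b) = (lmul a : E) ** lmul b :> E.
Proof. by apply: homP => s; rewrite endME !lmulE amulA. Qed.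

Lemma lmul1 : lmul (aone S) = aone E.
Proof. by apply: homP => s; rewrite lmulE amul1x. Qed.

Lemma bimul_lmul a phi b : bimul a phi b = (lmul a : E) ** phi ** lmul b :> E.
Proof. by apply: homP => s; rewrite !endME !lmulE. Qed.

Fact act_trilin (z : SE) :
  trilin (fun a b c => (a *t (lmul c : E)) ** z ** (aone S *t (lmul b : E))).
Proof.
split=> [b c|a c|a b] k x y; rewrite ?lmul_linear.
- by rewrite tensDl tensZl !(amulDl, amulZl).
- by rewrite tensDr tensZr amulDr amulZr.
- by rewrite tensDr tensZr !(amulDl, amulZl).
Qed.

(* a (x) b (x) c acts on S (x) End_R(S) by s (x) phi |-> a s (x) c phi b. *)
Definition act (z : SE) : {linear S3 S -> SE} := tlift3 (act_trilin z).

Lemma actE (z : SE) a b c :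
  act z (a *t b *t c) = (a *t (lmul c : E)) ** z ** (aone S *t (lmul b : E)).
Proof. exact: tlift3E. Qed.

Lemma act_linear x : linear (act^~ x).
Proof.
move=> k z w; apply: eq_tlift3_linear => a b c.
by rewrite amulDr amulZr amulDl amulZl.
Qed.

Lemma actDl (z w : SE) x : act (z + w) x = act z x + act w x.
Proof. by have := act_linear x 1 z w; rewrite !scale1r. Qed.

(** Right multiplications compose in reverse order; commutativity of S repairs this. Hence u and
    u^-1 act as mutually inverse maps. *)
Lemma actM (z : SE) x y : act z (x ** y) = act (act z y) x.
Proof.
elim/tens3_ind: x => [x x' hx hx'|a b c]; first by rewrite amulDl !linearD hx hx'.
elim/tens3_ind: y => [y y' hy hy'|a' b' c'].
  by rewrite amulDr !linearD actDl hy hy'.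
rewrite !tensME !actE (amulC b b') !lmulM -!amulA !tensME amul1x.
by rewrite !amulA tensME.
Qed.

Lemma act1 (z : SE) : act z (aone _) = z.
Proof. by rewrite [LHS]actE !lmul1 [LHS]amulx1 amul1x. Qed.

Fact act4_trilin (z : T) :
  trilin (fun a b c => (a *t aone E *t b) ** z ** (aone S *t (lmul c : E) *t aone S)).
Proof.
split=> [b c|a c|a b] k x y; rewrite ?lmul_linear.
- by rewrite !(tensDl, tensZl) !(amulDl, amulZl).
- by rewrite tensDr tensZr !(amulDl, amulZl).
- by rewrite tensDr tensZr tensDl tensZl amulDr amulZr.
Qed.

Fact act4_bilin2 (z : T) : bilin (fun (x : S3 S) d =>
  (aone S *t (lmul d : E) *t aone S) ** (tlift3 (act4_trilin z) x)).
Proof.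
split=> [d|x] k y w; first by rewrite linearP amulDr amulZr.
by rewrite lmul_linear tensDr tensZr tensDl tensZl amulDl amulZl.
Qed.

(* a (x) b (x) c (x) d acts on S (x) End_R(S) (x) S by                        *)
(* s (x) phi (x) t |-> a s (x) d phi c (x) b t.                               *)
Definition actT (z : T) : {linear S4 S -> T} := tlift (act4_bilin2 z).

Lemma actTE (z : T) a b c d : actT z (a *t b *t c *t d) =
  (a *t (lmul d : E) *t b) ** z ** (aone S *t (lmul c : E) *t aone S).
Proof. by rewrite /actT tliftE tlift3E !amulA !tensME !amul1x amulx1. Qed.

Lemma actT_linear (w : S4 S) : linear (actT^~ w).
Proof.
move=> k z z'; apply: eq_tlift_linear => x d.
rewrite -amulZr -amulDr; congr (_ ** _).
by apply: eq_tlift3_linear => a b c; rewrite amulDr amulZr amulDl amulZl.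
Qed.

Lemma actTDl (z z' : T) w : actT (z + z') w = actT z w + actT z' w.
Proof. by have := actT_linear w 1 z z'; rewrite !scale1r. Qed.

Lemma tens4_ind (P : S4 S -> Prop) : (forall z w, P z -> P w -> P (z + w)) ->
  (forall a b c d, P (a *t b *t c *t d)) -> forall z, P z.
Proof.
move=> PD Pp; elim/tens_ind=> [//|x d].
by elim/tens3_ind: x => [x y hx hy|a b c]; rewrite ?tensDl; [apply: PD|].
Qed.

Lemma actTM (z : T) (x y : S4 S) : actT z (x ** y) = actT (actT z y) x.
Proof.
elim/tens4_ind: x => [x x' hx hx'|a b c d].
  by rewrite amulDl !linearD hx hx'.
elim/tens4_ind: y => [y y' hy hy'|a' b' c' d'].
  by rewrite amulDr !linearD actTDl hy hy'.
rewrite !tensME !actTE (amulC c c') !lmulM -!amulA !tensME !amul1x.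
by rewrite !amulA !tensME.
Qed.

Lemma act_tens1 (z : SE) x : act z x *t aone S = actT (z *t aone S) (eta2 S x).
Proof.
elim/tens3_ind: x => [x x' hx hx'|a b c]; first by rewrite !linearD tensDl hx hx'.
by rewrite eta2E actTE actE !tensME !amulx1.
Qed.

Lemma tau_act (z : SE) x :
  tau S (aone S *t act z x) = actT (tau S (aone S *t z)) (eta1 S x).
Proof.
elim/tens3_ind: x => [x x' hx hx'|a b c].
  by rewrite !linearD tensDr linearD hx hx'.
rewrite eta1E actTE actE.
have <- : tau S (aone S *t (a *t (lmul c : E))) = aone S *t (lmul c : E) *t a.
  exact: tlift3rE.
have <- : tau S (aone S *t (aone S *t (lmul b : E))) =
          aone S *t (lmul b : E) *t aone S.
  exact: tlift3rE.
by rewrite -!tauM !tensME !amulx1.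
Qed.

(** After the reordering [tau], the map [Phi u] is thus the action of u_3 u_4^-1. *)
Lemma Phi_genT x y (z : tens S SE) :
  Phi_gen x y z = actT (tau S z) (eta3 S x ** eta4 S y).
Proof.
elim/tens3r_ind: z => [z z' hz hz'|s t phi].
  by rewrite !linearD actTDl hz hz'.
have tauE : tau S (s *t (t *t phi)) = s *t phi *t t by exact: tlift3rE.
rewrite Phi_genM tauE.
elim/tens3_ind: x => [x x' hx hx'|a b c].
  by rewrite (linearD (Defs.iota S)) (linearD (eta3 S)) !amulDl linearD hx hx'.
elim/tens3_ind: y => [y y' hy hy'|a' b' c'].
  by rewrite (linearD (Defs.iota S)) (linearD (eta4 S)) !amulDr linearD hy hy'.
rewrite /Defs.iota !tlift3E eta3E eta4E !tensME actTE !tensME !amulx1 amul1x.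
by rewrite -!amulA (amulC s) (amulC t).
Qed.

Fact right_factor_bilin psi :
  bilin (fun a b : S => a *t (bimul (aone S) psi b : E)).
Proof.
have [_ _ h] := bimul_trilin S.
by split=> [b|a] k x y; rewrite ?h (tensDl, tensDr) (tensZl, tensZr).
Qed.

Fact sandwich4_trilin phi psi : trilin (fun (x : S2 S) c d =>
  (aone S *t (bimul d phi c : E)) ** (tlift (right_factor_bilin psi) x)).
Proof.
have [h1 _ h3] := bimul_trilin S.
split=> [c d|x d|x c] k y z.
- by rewrite linearP amulDr amulZr.
- by rewrite h3 tensDr tensZr amulDl amulZl.
- by rewrite h1 tensDr tensZr amulDl amulZl.
Qed.

(* a (x) b (x) c (x) d |-> a (x) d phi c psi b *)
Definition sandwich4 phi psi : {linear S4 S -> SE} :=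
  tlift3 (sandwich4_trilin phi psi).

Lemma sandwich4E phi psi a b c d : sandwich4 phi psi (a *t b *t c *t d) =
  a *t (sandwich phi psi b c d : E).
Proof.
rewrite /sandwich4 tlift3E tliftE tensME amul1x; congr (_ *t _).
by apply: homP => s; rewrite endME !bimulE amul1x sandwichE.
Qed.

Lemma act_tens1l phi a b c :
  act (aone S *t phi) (a *t b *t c) = a *t (bimul c phi b : E).
Proof. by rewrite actE !tensME !amulx1 -bimul_lmul. Qed.

(** In (c phi b)(c' psi b') the scalars b and c' merge in slot 3; the left factor leaves slot 2
    empty, the right one slot 4. *)
Lemma act_amul phi psi x y : act (aone S *t phi) x ** act (aone S *t psi) y =
  sandwich4 phi psi (eta2 S x ** eta4 S y).
Proof.
elim/tens3_ind: x => [x x' hx hx'|a b c].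
  by rewrite !linearD !amulDl linearD hx hx'.
elim/tens3_ind: y => [y y' hy hy'|a' b' c'].
  by rewrite !linearD !amulDr linearD hy hy'.
rewrite !act_tens1l eta2E eta4E !tensME sandwich4E !amul1x amulx1.
by congr (_ *t _); apply: homP => s; rewrite endME !bimulE sandwichE !amulA.
Qed.

Lemma act_tw_mul phi psi x y : act (aone S *t (tw_mul y phi psi : E)) x =
  sandwich4 phi psi (eta3 S x ** eta1 S y).
Proof.
elim/tens3_ind: x => [x x' hx hx'|a b c].
  by rewrite !linearD amulDl linearD hx hx'.
elim/tens3_ind: y => [y y' hy hy'|a' b' c'].
  by rewrite tw_mulDx tensDr actDl hy hy' linearD amulDr linearD.
rewrite act_tens1l eta3E eta1E !tensME sandwich4E !amul1x amulx1.
congr (_ *t _); apply: homP => s; rewrite bimulE tw_mulE sandwichE.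
by rewrite !amulA (amulC b).
Qed.

(** Scalars on either side of [lmul a] commute past it, so the last two slots multiply; [Z2_right]
    then gives the image of the unit. *)
Lemma act_lmul x a :
  act (aone S *t (lmul a : E)) x =
  tmap (idfun : EndR S) (mkhom (@lmul_linear R S))
    ((mul_last S S x) ** (aone S *t a)).
Proof.
elim/tens3_ind: x => [x x' hx hx'|b c d].
  by rewrite !linearD amulDl linearD hx hx'.
rewrite act_tens1l mul_lastE tensME tmapE /= amulx1; congr (_ *t _).
apply: homP => s; rewrite bimulE !lmulE !amulA; congr (_ ** s).
by rewrite (amulC c d) -!amulA (amulC c).
Qed.

End Action.

(** * Descent by means of a retraction *)

Section Descent.
Variables (R : comPzRingType) (S : comPzAlgType R).
Local Notation E := (end_alg S).
Variables (r : {linear S -> R^o}) (r1 : r (aone S) = 1).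

Fact contract_bilin (M : lmodType R) : bilin (fun (s : S) (m : M) => (r s : R) *: m).
Proof.
split=> [m|s] k x y; first by rewrite linearP scalerDl scalerA.
by rewrite scalerDr !scalerA mulrC.
Qed.

Definition contract (M : lmodType R) : {linear tens S M -> M} :=
  tlift (contract_bilin M).

Lemma contractE (M : lmodType R) (s : S) (m : M) :
  contract M (s *t m) = (r s : R) *: m.
Proof. exact: tliftE. Qed.

Fact contract_last_bilin (M : lmodType R) :
  bilin (fun (m : M) (s : S) => (r s : R) *: m).
Proof. by have [h1 h2] := contract_bilin M; split. Qed.

(** Here [r] serves as contracting homotopy: it is applied to the last factor of both sides. *)
Lemma contract_descent (y : tens S E) : y *t aone S = tau S (aone S *t y) ->
  y = aone S *t contract E y.
Proof.
move=> /(congr1 (tlift (contract_last_bilin (tens S E)))).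
rewrite tliftE r1 scale1r => {1}->.
elim/tens_ind: y => [y z hy hz|s phi].
  by rewrite !(linearD, tensDr) hy hz.
rewrite contractE tensZr [tau _ _](tlift3rE (tau_trilin S)).
by rewrite tliftE.
Qed.

End Descent.

(** * Rearrangements of the cocycle condition *)

Section CocycleInverse.
Variables (R : comPzRingType) (S : comPzAlgType R) (u : Z2 S).

Let w : S3 S := Z2_val u.
Let v : S3 S := Z2_inv u.

Lemma Z2_eta2 : eta3 S w ** eta4 S v ** eta1 S w = eta2 S w.
Proof.
have e4 : eta4 S w ** eta4 S v = aone _.
  by rewrite -[LHS]eta4M Z2_mulV eta4_1.
rewrite -[LHS]amulA (amulC (eta4 S v)) amulA [eta3 S w ** _]Z2_eq.
by rewrite -[LHS]amulA e4 amulx1.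
Qed.

Lemma Z2_eta1_inv : eta2 S v ** (eta3 S w ** eta4 S v) = eta1 S v.
Proof.
have e1 : eta1 S v ** eta1 S w = aone _.
  by rewrite -[LHS]eta1M Z2_mulVr [LHS]eta1E.
by rewrite -[RHS]amulx1 -(Z2_cocycle u) !amulA e1 amul1x.
Qed.

End CocycleInverse.

Theorem theorem4p9 (R : comPzRingType) (S : comPzAlgType R)
    (hS : faithfully_projective S) (u : Z2 S) :
  exists gamma : {linear tw_alg u -> Asub_alg u},
    alg_morphism gamma /\ bijective gamma.
Proof.
have [r r1] := faithfully_projective_retraction hS.
pose w : S3 S := Z2_val u; pose v : S3 S := Z2_inv u.
have vw : v ** w = aone _ by exact: Z2_mulVr.
have wv : w ** v = aone _ by exact: Z2_mulV.
pose g (phi : tw_alg u) : tens S (end_alg S) := act (aone S *t phi) w.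
have tens1_tau (phi : end_alg S) : aone S *t phi *t aone S =
    tau S (aone S *t (aone S *t phi)).
  by rewrite [RHS](tlift3rE (tau_trilin S)).
have gA phi : in_A u (g phi).
  (* u_3 u_4^-1 u_1 = u_2, and both acted-on elements are 1 (x) phi (x) 1. *)
  apply/eqP; rewrite /Phi Phi_genT tau_act -actTM Z2_eta2 act_tens1.
  by rewrite tens1_tau.
pose gam phi : Asub_alg u := MkAsub (gA phi).
have gam_linear : linear gam.
  move=> k x y; apply: val_inj; rewrite /= /g tensDr tensZr.
  exact: act_linear.
exists (mkhom gam_linear); split; first split.
- apply: val_inj; rewrite /= /g.
  rewrite [LHS]act_lmul Z2_right tmapE /=; congr (_ *t _).
  exact: lmul1.
- move=> x y; apply: val_inj; rewrite /= /g.
  by rewrite [RHS]act_amul -Z2_eq -act_tw_mul.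
exists (fun x : Asub_alg u => contract r (end_alg S) (act (Asub_val x) v)).
  move=> phi; rewrite -[Asub_val _]/(act (aone S *t phi) w) -actM vw act1.
  by rewrite contractE r1 scale1r.
move=> x; apply: val_inj; rewrite -[LHS]/(act (aone S *t contract _ _ _) w).
rewrite -contract_descent //.
  by rewrite -actM wv act1.
(* The descent condition for u^-1 x: u_2^-1 from [act_tens1] and u_3 u_4^-1 from [Phi] combine to
   u_1^-1. *)
rewrite act_tens1 (eqP (Asub_valP x)) /Phi Phi_genT -actTM tau_act.
by rewrite Z2_eta1_inv.
Qed.
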